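(* Let $\mathbb{C}$ be a cartesian closed category and let $\mathcal{P} : \mathbb{C}^{\pm\,\mathsf{op}} \to \mathbf{Pos}$ be a polarized doctrine (on the polarization category $\mathbb{C}^{\pm}$ of $\mathbb{C}$, see context) whose fibers all have finite meets (binary meet written $\times$). Suppose that $\Rightarrow$ and $\Rightarrow'$ are two families of functors \[ \mathcal{P}(N \times N' \mid \Delta \mid P \times P')^{\mathsf{op}} \times \mathcal{P}(\Theta \times N \times P' \mid \Delta \mid \Gamma \times P \times N') \longrightarrow \mathcal{P}(\Theta \times P' \mid \Delta \times N \times P \mid \Gamma \times N') \] (one for each $\Theta,\Delta,\Gamma,N,N',P,P' \in \mathbb{C}$), each of which makes $\mathcal{P}$ have polarized exponentials in the sense of the context. Then the two are isomorphic: for all such objects and all $\psi \in \mathcal{P}(N\times N' \mid \Delta \mid P \times P')$, $\varphi \in \mathcal{P}(\Theta \times N \times P' \mid \Delta \mid \Gamma \times P \times N')$ one has $\psi \Rightarrow \varphi \le \psi \Rightarrow' \varphi$ and $\psi \Rightarrow' \varphi \le \psi \Rightarrow \varphi$ in $\mathcal{P}(\Theta \times P' \mid \Delta \times N \times P \mid \Gamma \times N')$.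
   Context: Composition is written in diagrammatic order $f ; g$, $\langle f,g\rangle$ is the pairing into a product, $!_X : X \to \top$ the map to the terminal object, and $\pi_i$ product projections; canonical isomorphisms reordering/reassociating factors of products are left implicit throughout. Polarization category $\mathbb{C}^{\pm}$ of a category $\mathbb{C}$ with finite products: objects are triples $(\Theta \mid \Delta \mid \Gamma)$ of objects of $\mathbb{C}$; a morphism $(\Theta\mid\Delta\mid\Gamma) \to (\Theta'\mid\Delta'\mid\Gamma')$ is a triple $(n : \Theta\times\Delta \to \Theta' \mid d : \Delta \to \Delta' \mid p : \Gamma \times \Delta \to \Gamma')$; identities are $(\pi_1 \mid \mathrm{id} \mid \pi_1)$; composition is $(n\mid d\mid p);(n'\mid d'\mid p') := (\langle n, \pi_2 ; d\rangle ; n' \mid d ; d' \mid \langle p, \pi_2 ; d\rangle ; p')$. Polarized doctrine: a cartesian closed $\mathbb{C}$ with a functor $\mathcal{P} : (\mathbb{C}^{\pm})^{\mathsf{op}} \to \mathbf{Pos}$ satisfying the no-dinatural-variance condition: for all $\Theta,\Delta,\Gamma$, the monotone map $\mathcal{P}(\mathrm{fl}_\Delta) : \mathcal{P}(\Theta\times\Delta \mid \top \mid \Gamma\times\Delta) \to \mathcal{P}(\Theta\mid\Delta\mid\Gamma)$ obtained by reindexing along $\mathrm{fl}_\Delta := (\mathrm{id}_{\Theta\times\Delta} \mid {!_\Delta} \mid \mathrm{id}_{\Gamma\times\Delta}) : (\Theta\mid\Delta\mid\Gamma) \to (\Theta\times\Delta\mid\top\mid\Gamma\times\Delta)$ is a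 bijection on underlying sets. Dinatural lift: for $N,P \in \mathbb{C}$, $\mathrm{lift}_{N,P} : (\Theta \mid \Delta\times N\times P \mid \Gamma) \to (\Theta\times N \mid \Delta \mid \Gamma \times P)$ is the morphism $(\langle\pi_1,\pi_3\rangle : \Theta\times\Delta\times N\times P \to \Theta\times N \mid \pi_1 : \Delta\times N\times P \to \Delta \mid \langle \pi_1,\pi_4\rangle : \Gamma\times\Delta\times N\times P \to \Gamma\times P)$, inducing $\mathcal{P}(\mathrm{lift}_{N,P}) : \mathcal{P}(\Theta\times N\mid\Delta\mid\Gamma\times P) \to \mathcal{P}(\Theta\mid\Delta\times N\times P\mid\Gamma)$. Polarized exponentials: a family of functors $\Rightarrow$ of the displayed type makes $\mathcal{P}$ have polarized exponentials iff for all $\Theta,\Delta,\Gamma,N,N',P,P'$, all $\Phi,\varphi \in \mathcal{P}(\Theta\times N\times P' \mid \Delta \mid \Gamma\times P\times N')$ and all $\psi \in \mathcal{P}(N\times N'\mid\Delta\mid P\times P')$: \[ \mathcal{P}(\pi_2\mid\mathrm{id}\mid\pi_2)\big(\mathcal{P}(\mathrm{lift}_{N',P'})(\psi)\big) \times \mathcal{P}(\mathrm{lift}_{N',P'})(\Phi) \le \mathcal{P}(\mathrm{lift}_{N',P'})(\varphi) \text{ in } \mathcal{P}(\Theta\times N\mid\Delta\times N'\times P'\mid\Gamma\times P) \] holds if and only if \[ \mathcal{P}(\mathrm{lift}_{N,P})(\Phi) \le \psi \Rightarrow \varphi \text{ in } \mathcal{P}(\Theta\times P'\mid\Delta\times N\times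 P\mid\Gamma\times N'), \] where $(\pi_2\mid\mathrm{id}\mid\pi_2) : (\Theta\times N \mid \Delta\times N'\times P' \mid \Gamma\times P) \to (N \mid \Delta\times N'\times P'\mid P)$ consists of the evident projections, and the reindexing functors preserve $\Rightarrow$. *)

(* Defs.v *)
From Stdlib Require Import Relation_Definitions FinFun.

Set Implicit Arguments.
Unset Strict Implicit.
Unset Printing Implicit Defensive.

Declare Scope cat_scope.
Delimit Scope cat_scope with cat.
Local Open Scope cat_scope.

(** * Categories, functors, posets *)

(** [comp f g] is diagrammatic: first [f], then [g]. *)
Record Category := {
  Ob :> Type;
  Hom : Ob -> Ob -> Type;
  idm : forall X, Hom X X;
  comp : forall X Y Z, Hom X Y -> Hom Y Z -> Hom X Z;
  comp_id_l : forall X Y (f : Hom X Y), comp (idm X) f = f;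
  comp_id_r : forall X Y (f : Hom X Y), comp f (idm Y) = f;
  comp_assoc : forall X Y Z W (f : Hom X Y) (g : Hom Y Z) (h : Hom Z W),
    comp (comp f g) h = comp f (comp g h)
}.

Arguments Hom {c} _ _.
Arguments idm {c} _.
Arguments comp {c X Y Z} _ _.

Notation "f ;; g" := (comp f g)
  (at level 45, right associativity) : cat_scope.

Definition op (C : Category) : Category := {|
  Ob := C;
  Hom := fun X Y => @Hom C Y X;
  idm := fun X => @idm C X;
  comp := fun X Y Z f g => @comp C Z Y X g f;
  comp_id_l := fun X Y f => @comp_id_r C Y X f;
  comp_id_r := fun X Y f => @comp_id_l C Y X f;
  comp_assoc := fun X Y Z W f g h => eq_sym (@comp_assoc C W Z Y X h g f)
|}.

Record Functor (C D : Category) := {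
  fob : C -> D;
  fmap : forall X Y : C, Hom X Y -> Hom (fob X) (fob Y);
  fmap_id : forall X, fmap (idm X) = idm (fob X);
  fmap_comp : forall X Y Z (f : Hom X Y) (g : Hom Y Z),
    fmap (f ;; g) = fmap f ;; fmap g
}.

Record Poset := {
  carrier :> Type;
  le : relation carrier;
  le_order : order carrier le
}.

Arguments le {p} _ _.

Record Monotone (A B : Poset) := {
  mono_fun :> A -> B;
  mono_le : forall x y, le x y -> le (mono_fun x) (mono_fun y)
}.

Definition mono_id (A : Poset) : Monotone A A :=
  {| mono_fun := fun x => x; mono_le := fun x y h => h |}.

Definition mono_comp (A B C : Poset) (f : Monotone A B) (g : Monotone B C) :
    Monotone A C :=
  {| mono_fun := fun x => g (f x);
     mono_le := fun x y h => mono_le g (mono_le f h) |}.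

Definition Pos : Category.
Proof.
  refine {| Ob := Poset; Hom := Monotone; idm := mono_id; comp := mono_comp |}.
  - intros X Y [f hf]; reflexivity.
  - intros X Y [f hf]; reflexivity.
  - reflexivity.
Defined.

Definition poset_op (A : Poset) : Poset.
Proof.
  refine {| carrier := A; le := fun x y => le y x |}.
  destruct (le_order A) as [r t a]; split.
  - exact r.
  - intros x y z hxy hyz; exact (t z y x hyz hxy).
  - intros x y hxy hyx; exact (a x y hyx hxy).
Defined.

Definition poset_prod (A B : Poset) : Poset.
Proof.
  refine {| carrier := A * B;
            le := fun x y => le (fst x) (fst y) /\ le (snd x) (snd y) |}.
  destruct (le_order A) as [ra ta aa], (le_order B) as [rb tb ab]; split.
  - intros x; split; [apply ra | apply rb].
  - intros x y z [h1 h2] [k1 k2]; split; [eapply ta | eapply tb]; eassumption.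
  - intros [x1 x2] [y1 y2] [h1 h2] [k1 k2]; simpl in *.
    rewrite (aa x1 y1 h1 k1), (ab x2 y2 h2 k2); reflexivity.
Defined.

Record FiniteMeets (A : Poset) := {
  top : A;
  meet : A -> A -> A;
  top_greatest : forall x, le x top;
  meet_glb : forall x y z, le z (meet x y) <-> le z x /\ le z y
}.

(** * Finite products and exponentials *)

Record CartesianCategory := {
  cc_cat :> Category;
  term : cc_cat;
  bang : forall X : cc_cat, Hom X term;
  bang_unique : forall (X : cc_cat) (f : Hom X term), f = bang X;
  prod : cc_cat -> cc_cat -> cc_cat;
  pr1 : forall {X Y : cc_cat}, Hom (prod X Y) X;
  pr2 : forall {X Y : cc_cat}, Hom (prod X Y) Y;
  pair : forall {Z X Y : cc_cat}, Hom Z X -> Hom Z Y -> Hom Z (prod X Y);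
  pair_pr1 : forall (Z X Y : cc_cat) (f : Hom Z X) (g : Hom Z Y),
    pair f g ;; pr1 = f;
  pair_pr2 : forall (Z X Y : cc_cat) (f : Hom Z X) (g : Hom Z Y),
    pair f g ;; pr2 = g;
  pair_unique : forall (Z X Y : cc_cat) (h : Hom Z (prod X Y)),
    h = pair (h ;; pr1) (h ;; pr2)
}.

Arguments term {c}.
Arguments bang {c} X.
Arguments prod {c} _ _.
Arguments pr1 {c X Y}.
Arguments pr2 {c X Y}.
Arguments pair {c Z X Y} _ _.

Notation "X × Y" := (prod X Y) (at level 40, left associativity) : cat_scope.
Notation "⟨ f , g ⟩" := (pair f g)
  (at level 0, f at level 99, g at level 99) : cat_scope.

Record CartesianClosedCategory := {
  ccc_cart :> CartesianCategory;
  expo : ccc_cart -> ccc_cart -> ccc_cart;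
  eval : forall {X Y : ccc_cart}, Hom (expo X Y × X) Y;
  curry : forall {Z X Y : ccc_cart}, Hom (Z × X) Y -> Hom Z (expo X Y);
  curry_eval : forall (Z X Y : ccc_cart) (f : Hom (Z × X) Y),
    ⟨pr1 ;; curry f, pr2⟩ ;; eval = f;
  curry_unique : forall (Z X Y : ccc_cart) (h : Hom Z (expo X Y)),
    h = curry (⟨pr1 ;; h, pr2⟩ ;; eval)
}.

(** * The polarization category *)

Section Polarization.

Variable C : CartesianCategory.

Lemma pair_comp (W Z X Y : C) (h : Hom W Z) (f : Hom Z X) (g : Hom Z Y) :
  h ;; ⟨f, g⟩ = ⟨h ;; f, h ;; g⟩.
Proof.
  rewrite (pair_unique (h ;; ⟨f, g⟩)), !comp_assoc, pair_pr1, pair_pr2.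
  reflexivity.
Qed.

Lemma pair_eta (X Y : C) : ⟨pr1, pr2⟩ = idm (X × Y).
Proof.
  rewrite (pair_unique (idm (X × Y))), !comp_id_l; reflexivity.
Qed.

Record PolOb := MkPolOb { neg : C; din : C; pos : C }.

Record PolHom (X Y : PolOb) := MkPolHom {
  hneg : Hom (neg X × din X) (neg Y);
  hdin : Hom (din X) (din Y);
  hpos : Hom (pos X × din X) (pos Y)
}.

Definition pol_id (X : PolOb) : PolHom X X :=
  @MkPolHom X X pr1 (idm (din X)) pr1.

Definition pol_comp (X Y Z : PolOb) (f : PolHom X Y) (g : PolHom Y Z) :
    PolHom X Z :=
  @MkPolHom X Z
    (⟨hneg f, pr2 ;; hdin f⟩ ;; hneg g)
    (hdin f ;; hdin g)
    (⟨hpos f, pr2 ;; hdin f⟩ ;; hpos g).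

Definition Pol : Category.
Proof.
  refine {| Ob := PolOb; Hom := PolHom; idm := pol_id; comp := pol_comp |}.
  - intros X Y [n d p]; unfold pol_comp; simpl.
    rewrite !comp_id_r, !pair_eta, !comp_id_l; reflexivity.
  - intros X Y [n d p]; unfold pol_comp; simpl.
    rewrite !pair_pr1, comp_id_r; reflexivity.
  - intros X Y Z W [n d p] [n' d' p'] [n'' d'' p'']; unfold pol_comp; simpl.
    rewrite <- !comp_assoc, !pair_comp, <- !comp_assoc, !pair_pr2.
    reflexivity.
Defined.

End Polarization.

Arguments MkPolOb {C} _ _ _.

Notation "⟪ A | D | B ⟫" := (MkPolOb A D B)
  (at level 0, A at level 99, D at level 99, B at level 99) : cat_scope.

Definition pol_hom (C : CartesianCategory) (A D B A' D' B' : C)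
    (n : Hom (A × D) A') (d : Hom D D') (p : Hom (B × D) B') :
    @Hom (Pol C) ⟪A | D | B⟫ ⟪A' | D' | B'⟫ :=
  @MkPolHom C ⟪A | D | B⟫ ⟪A' | D' | B'⟫ n d p.

Notation "⦅ n | d | p ⦆" := (pol_hom n d p)
  (at level 0, n at level 99, d at level 99, p at level 99) : cat_scope.

Section Morphisms.

Variable C : CartesianCategory.

(** The morphism given by plain maps of [C], with no dependence of the outer
    components on the dinatural one; used for the reorderings of factors. *)
Definition pure (A D B A' D' B' : C)
    (s : Hom A A') (d : Hom D D') (t : Hom B B') :
    @Hom (Pol C) ⟪A | D | B⟫ ⟪A' | D' | B'⟫ :=
  ⦅pr1 ;; s | d | pr1 ;; t⦆.

Definition exch (X Y Z : C) : Hom (X × Y × Z) (X × Z × Y) :=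
  ⟨⟨pr1 ;; pr1, pr2⟩, pr1 ;; pr2⟩.

Definition fl (Th De Ga : C) :
    @Hom (Pol C) ⟪Th | De | Ga⟫ ⟪Th × De | term | Ga × De⟫ :=
  ⦅idm (Th × De) | bang De | idm (Ga × De)⦆.

Definition lift (Th De Ga N P : C) :
    @Hom (Pol C) ⟪Th | De × N × P | Ga⟫ ⟪Th × N | De | Ga × P⟫ :=
  ⦅⟨pr1, pr2 ;; pr1 ;; pr2⟩ | pr1 ;; pr1 | ⟨pr1, pr2 ;; pr2⟩⦆.

(** Lift of [N] and [P] out of a predicate over
    (Th × N × P' | De | Ga × P × N'), i.e. [lift] followed by the reordering
    that brings [N] and [P] to the last position. *)
Definition lift_inner (Th De Ga N N' P P' : C) :
    @Hom (Pol C) ⟪Th × P' | De × N × P | Ga × N'⟫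
                 ⟪Th × N × P' | De | Ga × P × N'⟫ :=
  lift (Th × P') De (Ga × N') N P ;;
  pure (exch Th P' N) (idm De) (exch Ga N' P).

(** Lift of [N'] and [P'] out of a predicate over
    (Th × N × P' | De | Ga × P × N').  Here [P'] is the negative and [N'] the
    positive factor, so this is [lift] with the two exchanged, up to the
    reordering of De × N' × P'. *)
Definition lift_outer (Th De Ga N N' P P' : C) :
    @Hom (Pol C) ⟪Th × N | De × N' × P' | Ga × P⟫
                 ⟪Th × N × P' | De | Ga × P × N'⟫ :=
  pure (idm (Th × N)) (exch De N' P') (idm (Ga × P)) ;;
  lift (Th × N) De (Ga × P) P' N'.

Definition drop_context (Th De Ga N P : C) :
    @Hom (Pol C) ⟪Th × N | De | Ga × P⟫ ⟪N | De | P⟫ :=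
  ⦅pr1 ;; pr2 | idm De | pr1 ;; pr2⦆.

(** ** Simultaneous substitutions

    Substitutions for the factors of a product, each depending on its own
    variable and on a shared dinatural variable [D]. *)
Definition par (A A' B B' D : C) (f : Hom (A × D) A') (g : Hom (B × D) B') :
    Hom (A × B × D) (A' × B') :=
  ⟨⟨pr1 ;; pr1, pr2⟩ ;; f, ⟨pr1 ;; pr2, pr2⟩ ;; g⟩.

(** The data of three morphisms of [Pol C] with a common middle component:
    (Th1 | De1 | Ga1) -> (Th | De | Ga), (N1 | De1 | P1) -> (N | De | P)
    and (N1' | De1 | P1') -> (N' | De | P').  The next three definitions are
    the morphisms they induce between the three contexts in which
    [psi], [phi] and [psi => phi] live. *)
Section Substitution.

Variables (Th De Ga N N' P P' : C).
Variables (Th1 De1 Ga1 N1 N1' P1 P1' : C).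
Variables (d : Hom De1 De)
  (th : Hom (Th1 × De1) Th) (ga : Hom (Ga1 × De1) Ga)
  (n : Hom (N1 × De1) N) (p : Hom (P1 × De1) P)
  (n' : Hom (N1' × De1) N') (p' : Hom (P1' × De1) P').

Definition subst_ant :
    @Hom (Pol C) ⟪N1 × N1' | De1 | P1 × P1'⟫ ⟪N × N' | De | P × P'⟫ :=
  ⦅par n n' | d | par p p'⦆.

Definition subst_cons :
    @Hom (Pol C) ⟪Th1 × N1 × P1' | De1 | Ga1 × P1 × N1'⟫
                 ⟪Th × N × P' | De | Ga × P × N'⟫ :=
  ⦅par (par th n) p' | d | par (par ga p) n'⦆.

Definition subst_imp :
    @Hom (Pol C) ⟪Th1 × P1' | De1 × N1 × P1 | Ga1 × N1'⟫
                 ⟪Th × P' | De × N × P | Ga × N'⟫ :=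
  ⦅⟨pr1, pr2 ;; pr1 ;; pr1⟩ ;; par th p'
  | ⟨⟨pr1 ;; pr1 ;; d, ⟨pr1 ;; pr2, pr1 ;; pr1⟩ ;; n⟩,
     ⟨pr2, pr1 ;; pr1⟩ ;; p⟩
  | ⟨pr1, pr2 ;; pr1 ;; pr1⟩ ;; par ga n'⦆.

End Substitution.

End Morphisms.

(** * Polarized doctrines *)

Definition no_dinatural_variance (C : CartesianCategory)
    (P : Functor (op (Pol C)) Pos) : Prop :=
  forall Th De Ga : C, Bijective (mono_fun (fmap P (fl Th De Ga))).

Record PolarizedDoctrine (C : CartesianClosedCategory) := {
  pd_functor : Functor (op (Pol C)) Pos;
  pd_no_dinatural_variance : no_dinatural_variance pd_functor
}.

Definition fib (C : CartesianClosedCategory) (P : PolarizedDoctrine C)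
    (X : PolOb C) : Poset :=
  fob (pd_functor P) X.

Definition reindex (C : CartesianClosedCategory) (P : PolarizedDoctrine C)
    (X Y : PolOb C) (f : @Hom (Pol C) X Y) :
    Monotone (fib P Y) (fib P X) :=
  fmap (pd_functor P) f.

Coercion fib : PolarizedDoctrine >-> Funclass.

Arguments reindex {C} P {X Y} f.

(** * Polarized exponentials *)

Section PolarizedExponentials.

Variables (C : CartesianClosedCategory) (D : PolarizedDoctrine C).

(** A functor between posets is a monotone map. *)
Definition ImpFamily : Type :=
  forall Th De Ga N N' P P' : C,
    Monotone
      (poset_prod (poset_op (D ⟪N × N' | De | P × P'⟫))
                  (D ⟪Th × N × P' | De | Ga × P × N'⟫))
      (D ⟪Th × P' | De × N × P | Ga × N'⟫).

Definition imp_app (imp : ImpFamily) (Th De Ga N N' P P' : C)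
    (psi : D ⟪N × N' | De | P × P'⟫)
    (phi : D ⟪Th × N × P' | De | Ga × P × N'⟫) :
    D ⟪Th × P' | De × N × P | Ga × N'⟫ :=
  imp Th De Ga N N' P P' (Datatypes.pair psi phi).

Definition imp_adjunction (M : forall X : PolOb C, FiniteMeets (D X))
    (imp : ImpFamily) : Prop :=
  forall (Th De Ga N N' P P' : C)
    (Phi phi : D ⟪Th × N × P' | De | Ga × P × N'⟫)
    (psi : D ⟪N × N' | De | P × P'⟫),
    le (meet (M ⟪Th × N | De × N' × P' | Ga × P⟫)
          (reindex D (drop_context Th (De × N' × P') Ga N P)
            (reindex D (lift N De P N' P') psi))
          (reindex D (lift_outer Th De Ga N N' P P') Phi))
       (reindex D (lift_outer Th De Ga N N' P P') phi)
    <->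
    le (reindex D (lift_inner Th De Ga N N' P P') Phi)
       (imp_app imp psi phi).

(** Reindexing preserves [=>] in all seven variables of its context. *)
Definition imp_stable (imp : ImpFamily) : Prop :=
  forall (Th De Ga N N' P P' Th1 De1 Ga1 N1 N1' P1 P1' : C)
    (d : Hom De1 De)
    (th : Hom (Th1 × De1) Th) (ga : Hom (Ga1 × De1) Ga)
    (n : Hom (N1 × De1) N) (p : Hom (P1 × De1) P)
    (n' : Hom (N1' × De1) N') (p' : Hom (P1' × De1) P')
    (psi : D ⟪N × N' | De | P × P'⟫)
    (phi : D ⟪Th × N × P' | De | Ga × P × N'⟫),
    reindex D (subst_imp d th ga n p n' p') (imp_app imp psi phi)
    = imp_app imp
        (reindex D (subst_ant d n p n' p') psi)
        (reindex D (subst_cons d th ga n p n' p') phi).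

Definition has_polarized_exponentials
    (M : forall X : PolOb C, FiniteMeets (D X)) (imp : ImpFamily) : Prop :=
  imp_adjunction M imp /\ imp_stable imp.

End PolarizedExponentials.

(* Main.v *)
Require Import Defs.
Local Open Scope cat_scope.

(** The adjunction only tests [psi => phi] against predicates of the form
    [P(lift)(Phi)], so the usual Yoneda argument needs [psi => phi] itself to
    be of that form.  This is automatic when [N] and [P] are terminal, because
    the lift then has a retraction.  The general case reduces to that one by
    stability: substitute for [N] and [P] the corresponding projections out of
    the dinatural context De × N × P, leaving terminal objects in their place.
    The induced substitution on [psi => phi] has a section, which recovers the
    original comparison. *)

Section CartesianMaps.

Variable C : CartesianCategory.

Lemma pair_ext (Z X Y : C) (f g : Hom Z (X × Y)) :
  f ;; pr1 = g ;; pr1 -> f ;; pr2 = g ;; pr2 -> f = g.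
Proof.
  intros h1 h2.
  rewrite (pair_unique f), (pair_unique g), h1, h2; reflexivity.
Qed.

Lemma hom_term_eq (X : C) (f g : Hom X term) : f = g.
Proof. rewrite (bang_unique f), (bang_unique g); reflexivity. Qed.

Lemma pair_pr1_assoc (Z X Y W : C) (f : Hom Z X) (g : Hom Z Y) (h : Hom X W) :
  ⟨f, g⟩ ;; pr1 ;; h = f ;; h.
Proof. rewrite <- comp_assoc, pair_pr1; reflexivity. Qed.

Lemma pair_pr2_assoc (Z X Y W : C) (f : Hom Z X) (g : Hom Z Y) (h : Hom Y W) :
  ⟨f, g⟩ ;; pr2 ;; h = g ;; h.
Proof. rewrite <- comp_assoc, pair_pr2; reflexivity. Qed.

Lemma PolHom_ext (X Y : PolOb C) (f g : PolHom X Y) :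
  hneg f = hneg g -> hdin f = hdin g -> hpos f = hpos g -> f = g.
Proof.
  destruct f, g; simpl; intros -> -> ->; reflexivity.
Qed.

End CartesianMaps.

Ltac cart_norm :=
  repeat first
    [ rewrite comp_assoc | rewrite pair_comp
    | rewrite pair_pr1_assoc | rewrite pair_pr2_assoc
    | rewrite pair_pr1 | rewrite pair_pr2
    | rewrite comp_id_l | rewrite comp_id_r ].

Ltac cart_eq :=
  cart_norm;
  first [ reflexivity
        | apply hom_term_eq
        | apply pair_ext; cart_eq ].

Section TerminalContexts.

Variable C : CartesianCategory.

Definition unlift_term (Th De Ga N' P' : C) :
    @Hom (Pol C) ⟪Th × term × P' | De | Ga × term × N'⟫
                 ⟪Th × P' | De × term × term | Ga × N'⟫ :=
  ⦅pr1 ;; ⟨pr1 ;; pr1, pr2⟩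
  | ⟨⟨idm De, bang De⟩, bang De⟩
  | pr1 ;; ⟨pr1 ;; pr1, pr2⟩⦆.

(** Maps into [term] are unique, so the discarded factors can be refilled by [bang].
    Contravariantly, every predicate over the source of this lift is a reindexing along it. *)
Lemma lift_inner_unlift_term (Th De Ga N' P' : C) :
  lift_inner Th De Ga term N' term P' ;; unlift_term Th De Ga N' P'
  = idm (c := Pol C) _.
Proof.
  apply PolHom_ext; cbn; unfold exch; cart_eq.
Qed.

Definition add_terms (A E B : C) :
    @Hom (Pol C) ⟪A | E | B⟫ ⟪A | E × term × term | B⟫ :=
  ⦅pr1 | ⟨⟨idm E, bang E⟩, bang E⟩ | pr1⦆.

(** The values of [N] and [P] are read off the dinatural context [De × N × P], which frees their own
    slots to be [term]. *)
Definition subst_imp_proj (Th De Ga N N' P P' : C) :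
    @Hom (Pol C) ⟪Th × P' | De × N × P × term × term | Ga × N'⟫
                 ⟪Th × P' | De × N × P | Ga × N'⟫ :=
  subst_imp (De1 := De × N × P) (N1 := term) (P1 := term)
    (pr1 ;; pr1) pr1 pr1 (pr2 ;; pr1 ;; pr2) (pr2 ;; pr2) pr1 pr1.

Lemma add_terms_subst_imp_proj (Th De Ga N N' P P' : C) :
  add_terms (Th × P') (De × N × P) (Ga × N')
    ;; subst_imp_proj Th De Ga N N' P P'
  = idm (c := Pol C) _.
Proof.
  apply PolHom_ext; cbn; unfold par; cart_eq.
Qed.

End TerminalContexts.

Section Comparison.

Variables (C : CartesianClosedCategory) (D : PolarizedDoctrine C).

Lemma reindex_section {X Y : PolOb C} {f : @Hom (Pol C) X Y}
    {g : @Hom (Pol C) Y X} :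
  f ;; g = idm (c := Pol C) X -> forall x : D X, reindex D f (reindex D g x) = x.
Proof.
  intros h x.
  change ((fmap (pd_functor D) g ;; fmap (pd_functor D) f) x = x).
  rewrite <- fmap_comp.
  change (reindex D (comp (c := Pol C) f g) x = x).
  rewrite h.
  exact (f_equal (fun m => mono_fun m x) (fmap_id (pd_functor D) X)).
Qed.

Variable M : forall X : PolOb C, FiniteMeets (D X).

Lemma imp_le_of_lift_inner (imp imp' : ImpFamily D)
    (Himp : imp_adjunction M imp) (Himp' : imp_adjunction M imp')
    (Th De Ga N N' P P' : C)
    (psi : D ⟪N × N' | De | P × P'⟫)
    (phi Phi : D ⟪Th × N × P' | De | Ga × P × N'⟫) :
  reindex D (lift_inner Th De Ga N N' P P') Phi = imp_app imp psi phi ->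
  le (imp_app imp psi phi) (imp_app imp' psi phi).
Proof.
  intros e; rewrite <- e.
  (* The meet inequality is the same for both families: transpose down along [imp'], then up along
     [imp], reaching reflexivity. *)
  apply Himp', Himp; rewrite e.
  apply le_order.
Qed.

Lemma imp_le (imp imp' : ImpFamily D)
    (Himp : has_polarized_exponentials M imp)
    (Himp' : has_polarized_exponentials M imp')
    (Th De Ga N N' P P' : C)
    (psi : D ⟪N × N' | De | P × P'⟫)
    (phi : D ⟪Th × N × P' | De | Ga × P × N'⟫) :
  le (imp_app imp psi phi) (imp_app imp' psi phi).
Proof.
  destruct Himp as [adj stab], Himp' as [adj' stab'].
  (* With both sides written as reindexings along [add_terms], monotonicity leaves the comparison of
     their substituted forms. *)
  rewrite <- (reindex_section (add_terms_subst_imp_proj C Th De Ga N N' P P')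
                (imp_app imp psi phi)).
  rewrite <- (reindex_section (add_terms_subst_imp_proj C Th De Ga N N' P P')
                (imp_app imp' psi phi)).
  apply mono_le.
  unfold subst_imp_proj; rewrite stab, stab'.
  eapply imp_le_of_lift_inner; [exact adj | exact adj' |].
  (* The witness for [Phi] is the substituted exponential reindexed along [unlift_term]. *)
  exact (reindex_section (lift_inner_unlift_term _ _ _ _ _ _) _).
Qed.

End Comparison.

Theorem mainTheorem1 (C : CartesianClosedCategory) (D : PolarizedDoctrine C)
    (M : forall X : PolOb C, FiniteMeets (D X))
    (imp imp' : ImpFamily D)
    (Himp : has_polarized_exponentials M imp)
    (Himp' : has_polarized_exponentials M imp') :
  forall (Th De Ga N N' P P' : C)
    (psi : D ⟪N × N' | De | P × P'⟫)
    (phi : D ⟪Th × N × P' | De | Ga × P × N'⟫),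
    le (imp_app imp psi phi) (imp_app imp' psi phi) /\
    le (imp_app imp' psi phi) (imp_app imp psi phi).
Proof.
  intros; split; eapply imp_le; eassumption.
Qed.
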